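(* Let $A\in\mathbb{C}^{n\times n}$ be normal and let $E\in\mathbb{C}^{n\times n}$ be a normal matrix of rank one. Then $A_+=A+E$ is normal if and only if there exist $\theta\in\mathbb{C}$ with $|\theta|=1$ and $y\in\mathbb{C}$ such that the following holds, where $\ell=\{y+\rho\theta:\rho\in\mathbb{R}\}$ and $p$ is the number of eigenvalues of $A$ on $\ell$ (with $p\ge 1$): there exist a unitary $U\in\mathbb{C}^{n\times n}$ whose columns are eigenvectors of $A$ and a nonzero $r\in\mathbb{C}^p$ with $$U^*AU=\begin{bmatrix}\Lambda_p&\\&B\end{bmatrix},\qquad U^*EU=\begin{bmatrix}\theta rr^*&\\&0\end{bmatrix},$$ where $B$ is diagonal and $\Lambda_p=\theta R+yI_p$, with $R$ real diagonal, is the diagonal matrix containing the $p$ eigenvalues of $A$ that lie on $\ell$. In that case $n-p$ eigenvalues of $A$ (those of $B$) are also eigenvalues of $A_+$. The remaining $p$ eigenvalues of $A_+$ are the eigenvalues of $$\Lambda_p+\theta rr^*=\theta(R+rr^* )+yI_p,$$ and these interlace the $p$ eigenvalues of $A$ on $\ell$ with the additional $(p+1)$-st point $+\infty\theta$; that is, if $r_1\le\dots\le r_p$ are the eigenvalues of $R$ and $\rho_1\le\dots\le\rho_p$ those of $R+rr^*$, then $r_1\le\rho_1\le r_2\le\dots\le\rho_{p-1}\le r_p\le\rho_p$.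
   Context: Eigenvalues are counted with multiplicity. Empty blocks in matrices are zero blocks. *)

(* Defs.v *)
From HB Require Import structures.
From mathcomp Require Import all_boot all_order all_algebra.
From mathcomp Require Import complex.
From mathcomp Require Import boolp classical_sets reals.

Set Implicit Arguments.
Unset Strict Implicit.
Unset Printing Implicit Defensive.

Import Order.TTheory GRing.Theory Num.Theory.

Local Open Scope ring_scope.
Local Open Scope complex_scope.
Local Open Scope sesquilinear_scope.
Local Open Scope classical_set_scope.

(* The eigenvalues of [A], repeated according to algebraic multiplicity; only
   the multiset is meaningful, so it is always compared up to [perm_eq]. *)
Definition eigenvals (C : closedFieldType) n (A : 'M[C]_n) : seq C :=
  sval (closed_field_poly_normal (char_poly A)).

Lemma char_poly_eigenvals (C : closedFieldType) n (A : 'M[C]_n) :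
  char_poly A = \prod_(z <- eigenvals A) ('X - z%:P).
Proof.
rewrite /eigenvals; case: closed_field_poly_normal => s /= {1}->.
by rewrite (monicP (char_poly_monic A)) scale1r.
Qed.

(* MathComp's [eigenvalue]/[eigenspace] are about row vectors. *)
Definition col_eigenvector (C : fieldType) n (A : 'M[C]_n) (v : 'cV[C]_n) :=
  v != 0 /\ exists a : C, A *m v = a *: v.

Section Complex.
Variable R : realType.
Local Notation C := R[i].

Definition line (y theta : C) : set C := [set y + rho%:C * theta | rho in [set: R]].

Definition eigenvals_on n (A : 'M[C]_n) (l : set C) : seq C :=
  [seq z <- eigenvals A | z \in l].

Definition complexmx m n (M : 'M[R]_(m, n)) : 'M[C]_(m, n) :=
  map_mx (real_complex R) M.

(* [U^* A U = diag(theta D + y I_p, B)] and [U^* E U = diag(theta r r^*, 0)];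
   the equality [hpq] casts the [(p + q)]-dimensional block matrices to
   dimension [n]. *)
Definition rank_one_splitting n (A E : 'M[C]_n) (theta y : C) p q
    (hpq : (p + q)%N = n) (U : 'M[C]_n) (r : 'cV[C]_p)
    (D : 'M[R]_p) (B : 'M[C]_q) : Prop :=
  let Lambda : 'M[C]_p := theta *: complexmx D + y%:M in
  [/\ [/\ `|theta| = 1, p = size (eigenvals_on A (line y theta)) & (1 <= p)%N],
      [/\ U \is unitarymx & forall j, col_eigenvector A (col j U)],
      [/\ r != 0, is_diag_mx D & is_diag_mx B],
      perm_eq [seq Lambda i i | i <- enum 'I_p] (eigenvals_on A (line y theta)) &
      U^t* *m A *m U = castmx (hpq, hpq) (block_mx Lambda 0 0 B) /\
      U^t* *m E *m U = castmx (hpq, hpq) (block_mx (theta *: (r *m r^t*)) 0 0 0)].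

End Complex.

Definition sorted_eigenvals (R : realType) p (H : 'M[R[i]]_p) (s : seq R) : Prop :=
  sorted <=%R s /\ perm_eq [seq x%:C | x <- s] (eigenvals H).

(* [s_1 <= t_1 <= s_2 <= ... <= t_(p-1) <= s_p <= t_p], indexed from 0 *)
Definition interlacing (R : realType) p (s t : seq R) : Prop :=
  (forall i, (i < p)%N -> s`_i <= t`_i) /\
  (forall i, (i.+1 < p)%N -> t`_i <= s`_i.+1).

(* Main.v *)
(** Write [E = theta u u^*] with [|theta| = 1] and diagonalize [A] unitarily, with
    eigenvalues [d_j], so that [u] gets coordinates [x_j].  The self-commutator
    of [A + E] has [(j, k)] entry [(w_j - w_k) x_j x_k^*] with
    [w_j = theta^* d_j - theta d_j^*]; hence [A + E] is normal iff
    [Im (theta^* d_j)] is constant on the support of [x], that is, iff the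
    eigenvalues met by [u] lie on a common line of direction [theta].  On that
    line, after removing [theta] and the offset [y], the perturbation is
    [D -> D + r r^*] with [D] real diagonal, and interlacing follows by
    dimension count: if an inequality failed, the span of eigenvectors of [D]
    and that of [D + r r^*] (and, for the upper bound, the orthogonal complement
    of [r]) would have a common nonzero vector with contradictory Rayleigh
    quotients. *)
Require Import Defs.
From HB Require Import structures.
From mathcomp Require Import all_boot all_order all_algebra perm.
From mathcomp Require Import complex ring.
From mathcomp Require Import boolp classical_sets reals.

Set Implicit Arguments.
Unset Strict Implicit.
Unset Printing Implicit Defensive.

Import Order.TTheory GRing.Theory Num.Theory.

Local Open Scope ring_scope.
Local Open Scope complex_scope.
Local Open Scope sesquilinear_scope.

(** * Adjoints and unitary conjugation *)

Lemma adjmx_mul (C : numClosedFieldType) m n p (A : 'M[C]_(m, n)) (B : 'M[C]_(n, p)) :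
  (A *m B)^t* = B^t* *m A^t*.
Proof. by rewrite trmx_mul map_mxM. Qed.

Lemma adjmxD (C : numClosedFieldType) m n (A B : 'M[C]_(m, n)) :
  (A + B)^t* = A^t* + B^t*.
Proof. by apply/matrixP=> i j; rewrite !mxE rmorphD. Qed.

Lemma adjmxZ (C : numClosedFieldType) m n a (A : 'M[C]_(m, n)) :
  (a *: A)^t* = a^* *: A^t*.
Proof. by apply/matrixP=> i j; rewrite !mxE rmorphM. Qed.

Lemma mulmx_rank1 (C : numClosedFieldType) m n (A : 'M[C]_(m, n)) (x : 'cV[C]_n) :
  (A *m x) *m (A *m x)^t* = A *m (x *m x^t*) *m A^t*.
Proof. by rewrite adjmx_mul !mulmxA. Qed.

Lemma unitarymxK (C : numClosedFieldType) n (U : 'M[C]_n) :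
  U \is unitarymx -> U^t* *m U = 1%:M.
Proof.
by rewrite -trmxC_unitary => /unitarymxP; rewrite trmxCK.
Qed.

Lemma conj_unitarymxK (C : numClosedFieldType) n (U A : 'M[C]_n) :
  U \is unitarymx -> U *m (U^t* *m A *m U) *m U^t* = A.
Proof.
by move=> /unitarymxP UU; rewrite !mulmxA UU mul1mx -mulmxA UU mulmx1.
Qed.

(** * Matrices of rank one *)

Lemma mxrank1_factor (F : fieldType) m n (E : 'M[F]_(m, n)) : \rank E = 1%N ->
  exists (c : 'cV[F]_m) (r : 'rV[F]_n), [/\ c != 0, r != 0 & E = c *m r].
Proof.
move=> rkE; have E0 : E != 0 by rewrite -mxrank_eq0 rkE.
(* The types of the two bases mention [\rank E]; generalizing them first allows it to be rewritten
   to 1. *)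
move: (col_base E) (row_base E) (mulmx_base E); rewrite rkE => c r Ecr.
exists c, r; split=> //; apply: contra E0 => /eqP x0; apply/eqP.
  by rewrite -Ecr x0 mul0mx.
by rewrite -Ecr x0 mulmx0.
Qed.

Lemma adjmx_mul_eq0 (C : numClosedFieldType) n (c : 'cV[C]_n) :
  ((c^t* *m c) 0 0 == 0) = (c == 0).
Proof.
rewrite mxE psumr_eq0 => [|j _]; last by rewrite !mxE mulrC mul_conjC_ge0.
apply/allP/eqP => [c0|-> j _]; last by rewrite !mxE mulr0 eqxx.
apply/matrixP=> i j; rewrite (ord1 j) [RHS]mxE; apply/eqP.
by have := c0 i (mem_index_enum _); rewrite !mxE mulrC mul_conjC_eq0.
Qed.

(** For [E = c r], normality makes [c c^*] and [r^* r] proportional, which forces [c = al r^*]. The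
    phase of [al] becomes [theta], and the square root of its modulus is absorbed in [u]. *)
Lemma normal_rank1P (C : numClosedFieldType) n (E : 'M[C]_n) :
  E \is normalmx -> \rank E = 1%N ->
  exists (theta : C) (u : 'cV[C]_n),
    [/\ `|theta| = 1, u != 0 & E = theta *: (u *m u^t*)].
Proof.
move=> /normalmxP EE rkE.
have [c [r [c0 r0 Ecr]]] := mxrank1_factor rkE.
set a := (r *m r^t*) 0 0; set b := (c^t* *m c) 0 0.
have b0 : b != 0 by rewrite adjmx_mul_eq0.
have a0 : a != 0.
  have := adjmx_mul_eq0 (r^t*); rewrite trmxCK -/a => ->.
  by apply: contra r0 => /eqP /(congr1 (fun M => M^t*)); rewrite trmxCK => ->;
     apply/eqP/matrixP=> i j; rewrite !mxE rmorph0.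
(* [c r r^* c^* = r^* c^* c r] multiplied by [c] on the right *)
have key : (a * b) *: c = (b * (r *m c) 0 0) *: r^t*.
  have := congr1 (fun M => M *m c) EE; rewrite Ecr adjmx_mul.
  rewrite -!mulmxA [c^t* *m c]mx11_scalar -/b [r *m c]mx11_scalar.
  rewrite [c^t* *m (c *m _)]mulmxA [c^t* *m c]mx11_scalar -/b.
  rewrite [r *m (r^t* *m _)]mulmxA [r *m r^t*]mx11_scalar -/a.
  by rewrite -!scalar_mxM !mul_mx_scalar [_%:M 0 0]mxE mulr1n.
set al := (r *m c) 0 0 / a.
have cE : c = al *: r^t*.
  have ab0 : a * b != 0 by rewrite mulf_neq0.
  apply: (scalerI ab0); rewrite key scalerA; congr (_ *: _).
  by rewrite /al [a * b]mulrC -[RHS]mulrA [a * _]mulrC divfK.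
clearbody al.
have al0 : al != 0 by apply: contra c0 => /eqP al0; rewrite cE al0 scale0r.
have nal0 : `|al| != 0 by rewrite normr_eq0.
exists (al / `|al|), (sqrtC `|al| *: r^t*); split.
- by rewrite normrM normfV normr_id mulfV.
- rewrite scaler_eq0 negb_or sqrtC_eq0 nal0 /=.
  by apply: contra c0; rewrite cE => /eqP->; rewrite scaler0.
- rewrite adjmxZ trmxCK -scalemxAl -scalemxAr !scalerA Ecr {1}cE -scalemxAl.
  congr (_ *: _).
  rewrite conj_Creal ?ger0_real ?sqrtC_ge0 // -mulrA -expr2 sqrtCK.
  by rewrite divfK.
Qed.

(** * Normality of conjugates, affine images, blocks and rank-one updates *)

Lemma normalmx_unitary_conj (C : numClosedFieldType) n (U A : 'M[C]_n) :
  U \is unitarymx -> (U^t* *m A *m U \is normalmx) = (A \is normalmx).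
Proof.
move=> UU.
have conjM (M N : 'M[C]_n) : (U^t* *m M *m U) *m (U^t* *m N *m U) = U^t* *m (M *m N) *m U.
  by rewrite -!mulmxA [U *m (U^t* *m _)]mulmxA (unitarymxP UU) mul1mx.
have adjM : (U^t* *m A *m U)^t* = U^t* *m A^t* *m U.
  by rewrite !adjmx_mul trmxCK mulmxA.
apply/normalmxP/normalmxP; rewrite adjM !conjM => E.
  by rewrite -(conj_unitarymxK (_ *m _) UU) E conj_unitarymxK.
by rewrite E.
Qed.

Lemma normalmx_affine (C : numClosedFieldType) n (theta y : C) (H : 'M[C]_n) :
  H^t* = H -> theta *: H + y%:M \is normalmx.
Proof.
move=> HH; apply/normalmxP; rewrite adjmxD adjmxZ HH tr_scalar_mx map_scalar_mx /=.
rewrite !mulmxDl !mulmxDr -!scalemxAl -!scalemxAr !mul_mx_scalar !mul_scalar_mx.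
by rewrite !scalerA !scale_scalar_mx [y^* * y]mulrC [theta^* * theta]mulrC addrACA.
Qed.

Lemma normalmx_diag (C : numClosedFieldType) n (D : 'M[C]_n) :
  is_diag_mx D -> D \is normalmx.
Proof.
by move=> /diag_mxP[d ->]; apply/normalmxP; rewrite tr_diag_mx map_diag_mx diag_mx_comm.
Qed.

Lemma normalmx_block (C : numClosedFieldType) p q (A : 'M[C]_p) (B : 'M[C]_q) :
  A \is normalmx -> B \is normalmx -> block_mx A 0 0 B \is normalmx.
Proof.
move=> /normalmxP AA /normalmxP BB; apply/normalmxP.
rewrite tr_block_mx !trmx0 map_block_mx !map_mx0 !mulmx_block.
by rewrite !mul0mx !mulmx0 !addr0 !add0r AA BB.
Qed.

Lemma normal_diag_rank1 (C : numClosedFieldType) n (d : 'rV[C]_n) (theta : C)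
    (x : 'cV[C]_n) j k :
  diag_mx d + theta *: (x *m x^t*) \is normalmx -> x j 0 != 0 -> x k 0 != 0 ->
  theta^* * d 0 j - theta * (d 0 j)^* = theta^* * d 0 k - theta * (d 0 k)^*.
Proof.
move=> /normalmxP; rewrite adjmxD adjmxZ adjmx_mul trmxCK tr_diag_mx map_diag_mx.
rewrite !mulmxDl !mulmxDr -!scalemxAl -!scalemxAr !scalerA [theta^* * theta]mulrC.
(* The terms quadratic in [x x^*] cancel, then the products of the diagonal with its conjugate; only
   the terms mixing [d] and [x] remain. *)
rewrite !addrA => /addIr; rewrite diag_mxC -!addrA => /addrI.
move=> /matrixP /(_ j k); rewrite !(mul_diag_mx, mul_mx_diag) !mxE !big_ord1 !mxE => E xj xk.
have /mulIf : x j 0 * (x k 0)^* != 0 by rewrite mulf_neq0 ?conjC_eq0.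
apply; apply/eqP; rewrite -subr_eq0; move/eqP: E; rewrite -subr_eq0.
by congr (_ == 0); ring.
Qed.

(** * Multisets of eigenvalues *)

Lemma eigenvals_perm (C : closedFieldType) n (A : 'M[C]_n) (s : seq C) :
  char_poly A = \prod_(z <- s) ('X - z%:P) -> perm_eq (eigenvals A) s.
Proof. by rewrite char_poly_eigenvals => /prod_XsubC_eq. Qed.

Lemma size_eigenvals (C : closedFieldType) n (A : 'M[C]_n) :
  size (eigenvals A) = n.
Proof.
by have := size_char_poly A; rewrite char_poly_eigenvals size_prod_XsubC => -[].
Qed.

Lemma eigenvals_diag (C : closedFieldType) n (A : 'M[C]_n) :
  is_diag_mx A -> perm_eq (eigenvals A) [seq A i i | i <- enum 'I_n].
Proof.
move=> /is_diag_mx_is_trig Atrig; apply: eigenvals_perm.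
by rewrite char_poly_trig // big_map big_enum.
Qed.

Lemma eigenvals_block (C : closedFieldType) p q (A : 'M[C]_p) (B : 'M[C]_q) :
  perm_eq (eigenvals (block_mx A 0 0 B)) (eigenvals A ++ eigenvals B).
Proof.
apply: eigenvals_perm; rewrite big_cat /= -!char_poly_eigenvals.
by rewrite /char_poly char_block_diag_mx det_ublock.
Qed.

Lemma char_poly_similar (R : comNzRingType) n (P Q A : 'M[R]_n) :
  P *m Q = 1%:M -> char_poly (P *m A *m Q) = char_poly A.
Proof.
move=> PQ; rewrite /char_poly /char_poly_mx !map_mxM.
have PQX : map_mx polyC P *m map_mx polyC Q = 1%:M by rewrite -map_mxM PQ map_scalar_mx.
have -> : 'X%:M - map_mx polyC P *m map_mx polyC A *m map_mx polyC Q =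
    map_mx polyC P *m ('X%:M - map_mx polyC A) *m map_mx polyC Q.
  by rewrite mulmxBr mulmxBl mul_mx_scalar -scalemxAl PQX scalemx1.
by rewrite !det_mulmx mulrAC -det_mulmx PQX det1 mul1r.
Qed.

Lemma eigenvals_unitary_conj (C : numClosedFieldType) n (U A : 'M[C]_n) :
  U \is unitarymx -> perm_eq (eigenvals (U^t* *m A *m U)) (eigenvals A).
Proof.
move=> UU; apply: eigenvals_perm.
by rewrite char_poly_similar ?unitarymxK // char_poly_eigenvals.
Qed.

(** * Dimension count and Rayleigh quotients *)

Lemma exists_left_kernel (F : fieldType) m n (M : 'M[F]_(m, n)) :
  (n < m)%N -> exists2 v : 'rV[F]_m, v != 0 & v *m M = 0.
Proof.
move=> lt_nm; have /rowV0Pn[v /sub_kermxP vM v0] : kermx M != 0; last by exists v.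
by rewrite -mxrank_eq0 mxrank_ker subn_eq0 -ltnNge (leq_ltn_trans (rank_leq_col M)).
Qed.

(** The conditions say that [v] kills a single matrix with [#|S| + #|T| + k] columns, fewer than its
    rows. With [U] and [V] eigenbases, this is how spans of eigenvectors are intersected: a span is
    given by the coordinates that vanish on it. *)
Lemma exists_left_kernel_cols (F : fieldType) m k (U V : 'M[F]_m)
    (W : 'M[F]_(m, k)) (S T : {set 'I_m}) :
  (#|S| + #|T| + k < m)%N ->
  exists v : 'rV[F]_m, [/\ v != 0, v *m W = 0,
    {in S, forall j, (v *m U) 0 j = 0} & {in T, forall j, (v *m V) 0 j = 0}].
Proof.
move=> lt_m; pose cols (M : 'M[F]_m) (X : {set 'I_m}) := colsub (@enum_val _ (mem X)) M.
have colsP (M : 'M[F]_m) (X : {set 'I_m}) (v : 'rV[F]_m) :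
    v *m cols M X = 0 -> {in X, forall j, (v *m M) 0 j = 0}.
  move=> /matrixP vX j jX; have := vX 0 (enum_rank_in jX j).
  rewrite !mxE => vj; rewrite -[RHS]vj.
  by apply: eq_bigr => i _; rewrite !mxE enum_rankK_in.
have [v v0] := exists_left_kernel (row_mx (row_mx (cols U S) (cols V T)) W) lt_m.
rewrite !mul_mx_row -[X in _ = X -> _]row_mx0 => /eq_row_mx[].
rewrite -[X in _ = X -> _]row_mx0.
by move=> /eq_row_mx[/colsP vS /colsP vT] vW; exists v.
Qed.

Lemma quad_form_diag (C : numClosedFieldType) n (U : 'M[C]_n) (d v : 'rV[C]_n) :
  (v *m (U *m diag_mx d *m U^t*) *m v^t*) 0 0 =
  \sum_j d 0 j * `|(v *m U) 0 j| ^+ 2.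
Proof.
rewrite !mulmxA -[_ *m U^t* *m _]mulmxA -adjmx_mul mul_mx_diag mxE.
by apply: eq_bigr => j _; rewrite !mxE normCK -mulrA mulrCA.
Qed.

(** The squared norm is the quadratic form of the identity, with all eigenvalues 1. *)
Lemma sqnorm_unitary (C : numClosedFieldType) n (U : 'M[C]_n) (v : 'rV[C]_n) :
  U \is unitarymx -> (v *m v^t*) 0 0 = \sum_j `|(v *m U) 0 j| ^+ 2.
Proof.
move=> /unitarymxP UU.
have := quad_form_diag U (const_mx 1) v; rewrite diag_const_mx mulmx1 UU mulmx1 => ->.
by apply: eq_bigr => j _; rewrite mxE mul1r.
Qed.

(** In eigencoordinates the form is a sum of squared moduli weighted by eigenvalues, so only
    eigenvalues at nonzero coordinates of [v] have to be bounded. *)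
Lemma quad_form_le (C : numClosedFieldType) n (U : 'M[C]_n) (d v : 'rV[C]_n) c :
  U \is unitarymx -> (forall j, (v *m U) 0 j != 0 -> d 0 j <= c) ->
  (v *m (U *m diag_mx d *m U^t*) *m v^t*) 0 0 <= c * (v *m v^t*) 0 0.
Proof.
move=> UU dc; rewrite quad_form_diag (sqnorm_unitary _ UU) mulr_sumr ler_sum // => j _.
have [->|/dc] := eqVneq ((v *m U) 0 j) 0; first by rewrite normr0 expr0n /= !mulr0.
by apply: ler_wpM2r; rewrite exprn_ge0.
Qed.

Lemma quad_form_ge (C : numClosedFieldType) n (U : 'M[C]_n) (d v : 'rV[C]_n) c :
  U \is unitarymx -> (forall j, (v *m U) 0 j != 0 -> c <= d 0 j) ->
  c * (v *m v^t*) 0 0 <= (v *m (U *m diag_mx d *m U^t*) *m v^t*) 0 0.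
Proof.
move=> UU dc; rewrite quad_form_diag (sqnorm_unitary _ UU) mulr_sumr ler_sum // => j _.
have [->|/dc] := eqVneq ((v *m U) 0 j) 0; first by rewrite normr0 expr0n /= !mulr0.
by apply: ler_wpM2r; rewrite exprn_ge0.
Qed.

(** * Counting in sorted lists, and interlacing *)

Lemma card_count_enum (T : finType) (U : eqType) (f : T -> U) (P : pred U) s :
  perm_eq s [seq f x | x <- enum T] -> #|[set x | P (f x)]| = count P s.
Proof.
by move=> /seq.permP->; rewrite count_map -sum1_count big_enum_cond sum1dep_card.
Qed.

(** Counting strict inequalities keeps this bound and the next valid for repeated eigenvalues. *)
Lemma count_lt_nth_sorted d (T : orderType d) (x0 : T) (s : seq T) i :
  sorted <=%O s -> (count (fun x => x < nth x0 s i)%O s <= i)%N.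
Proof.
by move=> ss; rewrite leqNgt; apply/negP => /(nth_count_lt x0 ss); rewrite ltxx.
Qed.

Lemma count_gt_nth_sorted d (T : orderType d) (x0 : T) (s : seq T) i :
  sorted <=%O s -> (i < size s)%N ->
  (count (fun x => nth x0 s i < x)%O s + i < size s)%N.
Proof.
move=> ss i_s; rewrite -[X in (_ < X)%N](count_predC (fun x => nth x0 s i < x)%O) ltn_add2l.
rewrite (eq_count (a2 := fun x => x <= nth x0 s i)%O) => [|x]; last by rewrite /= leNgt.
rewrite ltnNge; apply/negP => le_i.
have: (nth x0 s i < nth x0 s i)%O by apply: nth_count_gt => //; apply/andP; split.
by rewrite ltxx.
Qed.

Lemma interlacing_rank1 (R : realType) p (U V : 'M[R[i]]_p) (d e : 'rV[R]_p)
    (r : 'cV[R[i]]_p) (s t : seq R) :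
  U \is unitarymx -> V \is unitarymx ->
  V *m diag_mx (complexmx e) *m V^t* = U *m diag_mx (complexmx d) *m U^t* + r *m r^t* ->
  sorted <=%R s -> perm_eq s [seq d 0 j | j <- enum 'I_p] ->
  sorted <=%R t -> perm_eq t [seq e 0 j | j <- enum 'I_p] ->
  interlacing p s t.
Proof.
move=> UU VU VE ss sd st te.
have szs : size s = p by rewrite (perm_size sd) size_map size_enum_ord.
have szt : size t = p by rewrite (perm_size te) size_map size_enum_ord.
have quadE (v : 'rV_p) : (v *m (V *m diag_mx (complexmx e) *m V^t*) *m v^t*) 0 0 =
    (v *m (U *m diag_mx (complexmx d) *m U^t*) *m v^t*) 0 0 + `|(v *m r) 0 0| ^+ 2.
  rewrite VE mulmxDr mulmxDl mxE; congr (_ + _).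
  by rewrite mulmxA -mulmxA -adjmx_mul mxE big_ord1 !mxE normCK.
have norm_gt0 (v : 'rV[R[i]]_p) : v != 0 -> 0 < (v *m v^t*) 0 0.
  move=> v0; have -> : v *m v^t* = (v^t*)^t* *m v^t* by rewrite trmxCK.
  rewrite lt_def adjmx_mul_eq0; apply/andP; split.
    by apply: contra v0 => /eqP v0; rewrite -[v]trmxCK v0 trmx0 map_mx0.
  by rewrite trmxCK mxE sumr_ge0 // => j _; rewrite !mxE mul_conjC_ge0.
split=> i lt_ip.
- rewrite leNgt; apply/negP => lt_ts.
  (* At most [i + (p - i - 1) = p - 1] conditions are imposed, and none from [r]. The vector found
     has quotient at least [s_i] for the first matrix and at most [t_i] for the second, although
     adding [r r^*] cannot lower it. *)
  have [|v [v0 _ vS vT]] := @exists_left_kernel_cols _ p 0 U V 0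
      [set j | d 0 j < s`_i] [set j | t`_i < e 0 j].
    (* The diagonals [d] and [e] are unsorted, so the index sets are measured in the sorted
       lists. *)
    rewrite (card_count_enum (fun x => x < s`_i) sd).
    rewrite (card_count_enum (fun x => t`_i < x) te).
    have le_i : (count (fun x => x < s`_i)%R s <= i)%N by exact: count_lt_nth_sorted.
    have : (count (fun x => t`_i < x)%R t + i < size t)%N.
      by apply: count_gt_nth_sorted; rewrite ?szt.
    rewrite szt => lt_p; rewrite addn0 addnC; apply: leq_trans lt_p.
    by rewrite ltnS leq_add2l.
  have lo : (s`_i)%:C * (v *m v^t*) 0 0 <=
      (v *m (U *m diag_mx (complexmx d) *m U^t*) *m v^t*) 0 0.
    apply: (quad_form_ge UU) => j; apply: contraR; rewrite mxE lecR -ltNge => dj.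
    by rewrite vS ?inE.
  have hi : (v *m (V *m diag_mx (complexmx e) *m V^t*) *m v^t*) 0 0 <=
      (t`_i)%:C * (v *m v^t*) 0 0.
    apply: (quad_form_le VU) => j; apply: contraR; rewrite mxE lecR -ltNge => ej.
    by rewrite vT ?inE.
  have: (s`_i)%:C * (v *m v^t*) 0 0 <= (t`_i)%:C * (v *m v^t*) 0 0.
    by rewrite quadE in hi; apply: le_trans (le_trans lo _) hi; rewrite lerDl exprn_ge0.
  by rewrite ler_pM2r ?norm_gt0 // lecR leNgt lt_ts.
- rewrite leNgt; apply/negP => lt_st.
  (* Orthogonality to [r] costs one condition and makes both quadratic forms agree at [v]. The total
     is at most [(p - i - 2) + i + 1 = p - 1]. *)
  have [|v [v0 vr vS vT]] := @exists_left_kernel_cols _ p 1 U V r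
      [set j | s`_i.+1 < d 0 j] [set j | e 0 j < t`_i].
    rewrite (card_count_enum (fun x => s`_i.+1 < x) sd).
    rewrite (card_count_enum (fun x => x < t`_i) te).
    have le_i : (count (fun x => x < t`_i)%R t <= i)%N by exact: count_lt_nth_sorted.
    have : (count (fun x => s`_i.+1 < x)%R s + i.+1 < size s)%N.
      by apply: count_gt_nth_sorted; rewrite ?szs.
    rewrite szs => lt_p; rewrite -addnA; apply: leq_trans lt_p.
    by rewrite ltnS leq_add2l addn1 ltnS.
  have lo : (t`_i)%:C * (v *m v^t*) 0 0 <=
      (v *m (V *m diag_mx (complexmx e) *m V^t*) *m v^t*) 0 0.
    apply: (quad_form_ge VU) => j; apply: contraR; rewrite mxE lecR -ltNge => dj.
    by rewrite vT ?inE.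
  have hi : (v *m (U *m diag_mx (complexmx d) *m U^t*) *m v^t*) 0 0 <=
      (s`_i.+1)%:C * (v *m v^t*) 0 0.
    apply: (quad_form_le UU) => j; apply: contraR; rewrite mxE lecR -ltNge => ej.
    by rewrite vS ?inE.
  have: (t`_i)%:C * (v *m v^t*) 0 0 <= (s`_i.+1)%:C * (v *m v^t*) 0 0.
    rewrite quadE vr [(0 : 'M__) 0 0]mxE normr0 expr0n addr0 in lo.
    exact: le_trans lo hi.
  by rewrite ler_pM2r ?norm_gt0 // lecR leNgt lt_st.
Qed.

Lemma hermitian_spectral (R : realType) n (H : 'M[R[i]]_n) : H^t* = H ->
  exists (U : 'M[R[i]]_n) (d : 'rV[R]_n),
    U \is unitarymx /\ H = U *m diag_mx (complexmx d) *m U^t*.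
Proof.
move=> HH; have Hherm : H \is hermsymmx.
  by apply/is_hermitianmxP; rewrite expr0 scale1r HH.
have PU := spectral_unitarymx H.
have /mxOverP dreal := hermitian_spectral_diag_real Hherm.
exists ((spectralmx H)^t*), (map_mx (@complex.Re R) (spectral_diag H)).
rewrite trmxC_unitary trmxCK; split=> //.
have -> : complexmx (map_mx (@complex.Re R) (spectral_diag H)) = spectral_diag H.
  by apply/matrixP => i j; rewrite !mxE RRe_real.
by rewrite -invmx_unitary //; apply/orthomx_spectralP/hermitian_normalmx.
Qed.

(** Used to bring the eigenvalues on the line to the front. The indices satisfying [P], followed by
    the others, rearrange the enumeration of ['I_n]; that rearrangement is [s]. *)
Lemma exists_split_perm n (P : pred 'I_n) :
  exists (p q : nat) (s : 'S_n), (p + q)%N = n /\ forall i, P (s i) = (i < p)%N.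
Proof.
pose l := [seq i <- enum 'I_n | P i] ++ [seq i <- enum 'I_n | predC P i].
have /tuple_permP[s ls] : perm_eq l (ord_tuple n).
  by rewrite (permEl (perm_filterC P (enum 'I_n))).
exists (size [seq i <- enum 'I_n | P i]), (size [seq i <- enum 'I_n | predC P i]), s.
split=> [|i]; first by rewrite -size_cat -/l ls size_tuple.
have <- : nth i l i = s i.
  by rewrite ls -tnth_nth tnth_mktuple tnth_ord_tuple.
rewrite nth_cat; case: ltnP => [lt_ip|le_pi].
  by have := mem_nth i lt_ip; rewrite mem_filter => /andP[].
have /(mem_nth i) : (i - size [seq i <- enum 'I_n | P i] <
                     size [seq i <- enum 'I_n | predC P i])%N.
  by rewrite ltn_subLR // -size_cat -/l ls size_tuple.
by rewrite mem_filter => /andP[/negPf].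
Qed.

(** * From the splitting to normality *)

Lemma splittingD (R : realType) n (A E : 'M[R[i]]_n) (theta y : R[i]) p q
    (hpq : (p + q)%N = n) U r (D : 'M[R]_p) (B : 'M_q) :
  rank_one_splitting A E theta y hpq U r D B ->
  U^t* *m (A + E) *m U = castmx (hpq, hpq)
    (block_mx (theta *: complexmx D + y%:M + theta *: (r *m r^t*)) 0 0 B).
Proof.
move=> [_ _ _ _ [AE EE]]; rewrite mulmxDr mulmxDl AE EE.
by case: n / hpq {AE EE A E U}; rewrite !castmx_id add_block_mx !addr0.
Qed.

Lemma complexmx_diag (R : realType) p (d : 'rV[R]_p) :
  complexmx (diag_mx d) = diag_mx (complexmx d).
Proof. exact: map_diag_mx. Qed.

Lemma adjmx_complexmx_diag (R : realType) p (d : 'rV[R]_p) :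
  (diag_mx (complexmx d))^t* = diag_mx (complexmx d).
Proof.
rewrite tr_diag_mx map_diag_mx; congr diag_mx; apply/matrixP=> i j.
by rewrite !mxE; apply: conj_Creal; apply/complex_realP; exists (d i j).
Qed.

Lemma adjmx_rank1 (C : numClosedFieldType) p (r : 'cV[C]_p) : (r *m r^t*)^t* = r *m r^t*.
Proof. by rewrite adjmx_mul trmxCK. Qed.

(** After conjugation by [U] both diagonal blocks are normal: the first is an affine image of the
    Hermitian matrix [D + r r^*], the second is diagonal. *)
Lemma splitting_normal (R : realType) n (A E : 'M[R[i]]_n) (theta y : R[i]) p q
    (hpq : (p + q)%N = n) U r (D : 'M[R]_p) (B : 'M_q) :
  rank_one_splitting A E theta y hpq U r D B -> A + E \is normalmx.
Proof.
move=> spl; have [_ [UU _] [_ /diag_mxP[d Dd] Bdiag] _ _] := spl.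
rewrite -(normalmx_unitary_conj _ UU) (splittingD spl).
case: n / hpq {spl A E U UU}; rewrite castmx_id.
apply: normalmx_block; last exact: normalmx_diag.
rewrite addrAC -scalerDr; apply: normalmx_affine.
by rewrite adjmxD adjmx_rank1 Dd complexmx_diag adjmx_complexmx_diag.
Qed.

(** * Eigenvalues of the perturbed block *)

Lemma eigenvals_castmx (C : closedFieldType) m n (h : m = n) (M : 'M[C]_m) :
  eigenvals (castmx (h, h) M) = eigenvals M.
Proof. by case: n / h; rewrite castmx_id. Qed.

(** The basis [U] also diagonalizes the affine image, which carries each real eigenvalue to its
    point on the line. *)
Lemma eigenvals_affine_spectral (R : realType) n (U : 'M[R[i]]_n)
    (d : 'rV[R]_n) (theta y : R[i]) :
  U \is unitarymx ->
  perm_eq (eigenvals (theta *: (U *m diag_mx (complexmx d) *m U^t*) + y%:M))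
          [seq y + x%:C * theta | x <- [seq d 0 j | j <- enum 'I_n]].
Proof.
move=> UU; have VU : U^t* *m U = 1%:M by exact: unitarymxK.
rewrite -(permPl (eigenvals_unitary_conj _ UU)).
have -> : U^t* *m (theta *: (U *m diag_mx (complexmx d) *m U^t*) + y%:M) *m U =
    diag_mx (\row_j (y + (d 0 j)%:C * theta)).
  rewrite mulmxDr mulmxDl mul_mx_scalar -scalemxAl VU -scalemxAr -scalemxAl !mulmxA VU mul1mx.
  rewrite -mulmxA VU mulmx1; apply/matrixP=> i j; rewrite !mxE.
  by case: eqVneq => [->|_]; rewrite ?mulr0n ?mulr0 ?addr0 ?mulr1n ?mulr1 // addrC mulrC.
apply: perm_trans (eigenvals_diag (diag_mx_is_diag _)) _.
rewrite -(map_comp (fun x => y + x%:C * theta) (d 0)).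
rewrite [X in perm_eq X _](eq_map (g := fun j => y + (d 0 j)%:C * theta)) // => j.
by rewrite !mxE eqxx.
Qed.

Lemma eigenvals_spectral (R : realType) n (U : 'M[R[i]]_n) (d : 'rV[R]_n) :
  U \is unitarymx ->
  perm_eq [seq x%:C | x <- [seq d 0 j | j <- enum 'I_n]]
          (eigenvals (U *m diag_mx (complexmx d) *m U^t*)).
Proof.
move=> /(eigenvals_affine_spectral d 1 0); rewrite scale1r raddf0 addr0 perm_sym.
by rewrite (eq_map (g := fun x => x%:C)) // => x; rewrite add0r mulr1.
Qed.

(** The same real lists [s] and [t] must serve as spectra of the Hermitian matrices and as
    coordinates of the complex eigenvalues, so all these facts are obtained together. *)
Lemma rank1_interlacing (R : realType) p (theta y : R[i]) (r : 'cV[R[i]]_p) (D : 'M[R]_p) :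
  is_diag_mx D ->
  exists s t : seq R,
    [/\ sorted_eigenvals (complexmx D) s,
        sorted_eigenvals (complexmx D + r *m r^t*) t,
        perm_eq [seq (theta *: complexmx D + y%:M) i i | i <- enum 'I_p]
                [seq y + x%:C * theta | x <- s],
        perm_eq (eigenvals (theta *: (complexmx D + r *m r^t*) + y%:M))
                [seq y + x%:C * theta | x <- t] &
        interlacing p s t].
Proof.
move=> /diag_mxP[d ->]; rewrite complexmx_diag.
(* The matrix [D] is already diagonal, so the identity is its eigenbasis. *)
have U1 : (1%:M : 'M[R[i]]_p) \is unitarymx.
  by apply/unitarymxP; rewrite mul1mx tr_scalar_mx map_scalar_mx rmorph1.
have D1 : diag_mx (complexmx d) = 1%:M *m diag_mx (complexmx d) *m 1%:M^t*.
  by rewrite mul1mx tr_scalar_mx map_scalar_mx rmorph1 mulmx1.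
have [|V [e [VV HE]]] := @hermitian_spectral _ _ (diag_mx (complexmx d) + r *m r^t*).
  by rewrite adjmxD adjmx_rank1 adjmx_complexmx_diag.
pose sd := [seq d 0 j | j <- enum 'I_p]; pose se := [seq e 0 j | j <- enum 'I_p].
have sortP (l : seq R) : perm_eq (sort <=%R l) l by rewrite perm_sort.
exists (sort <=%R sd), (sort <=%R se); split.
- split; first exact: sort_le_sorted.
  by rewrite (permPl (perm_map _ (sortP _))) D1 eigenvals_spectral.
- split; first exact: sort_le_sorted.
  by rewrite (permPl (perm_map _ (sortP _))) HE eigenvals_spectral.
- rewrite (permPr (perm_map _ (sortP _))) /sd -(map_comp (fun x => y + x%:C * theta) (d 0)).
  rewrite [X in perm_eq X _](eq_map (g := fun j => y + (d 0 j)%:C * theta)) // => j.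
  by rewrite !mxE eqxx /= addrC mulrC.
- by rewrite (permPr (perm_map _ (sortP _))) HE eigenvals_affine_spectral.
- by apply: (interlacing_rank1 U1 VV _ _ (sortP _) _ (sortP _));
     rewrite ?sort_le_sorted // -D1 -HE.
Qed.

(** * From normality to the splitting *)

Lemma col_eigenvector_spectral (C : numClosedFieldType) n (U : 'M[C]_n) (d : 'rV[C]_n) j :
  U \is unitarymx -> col_eigenvector (U *m diag_mx d *m U^t*) (col j U).
Proof.
move=> UU; have VU := unitarymxK UU; split.
  (* A zero column would make the diagonal entry [(j, j)] of [U^* U = 1] vanish. *)
  apply/eqP => Uj0; have /matrixP/(_ j j) := VU.
  rewrite !mxE eqxx big1 => [/eqP|k _]; first by rewrite eq_sym oner_eq0.
  by move/matrixP: Uj0 => /(_ k 0); rewrite !mxE => ->; rewrite mulr0.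
exists (d 0 j).
rewrite colE -!mulmxA [U^t* *m (U *m _)]mulmxA VU mul1mx scalemxAr; congr (U *m _).
by apply/matrixP=> i k; rewrite mul_diag_mx !mxE; case: eqVneq => [->//|_]; rewrite !mulr0.
Qed.

Lemma line_coord (R : realType) (theta y z : R[i]) : `|theta| = 1 ->
  z \in line y theta -> z = theta * (complex.Re ((z - y) / theta))%:C + y.
Proof.
move=> th1; rewrite inE => -[rho _ <-].
have th0 : theta != 0 by rewrite -normr_eq0 th1 oner_eq0.
by rewrite [y + _]addrC addrK mulfK //= mulrC.
Qed.

(** The hypothesis says that conjugation fixes [theta^* (a - b)]. For [theta] of modulus 1 this puts
    [a] on the line through [b] in direction [theta]. *)
Lemma real_conj_mul_sub (C : numClosedFieldType) (theta a b : C) :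
  theta^* * a - theta * a^* = theta^* * b - theta * b^* ->
  theta^* * (a - b) \is Num.real.
Proof.
move=> ab; apply/CrealP; rewrite rmorphM rmorphB /= conjCK; apply/eqP.
rewrite -subr_eq0; move/eqP: ab; rewrite -subr_eq0 -oppr_eq0.
by congr (_ == 0); ring.
Qed.

(** Once the eigenvalues on the line occupy the first [p] positions, [x] is supported there, and its
    upper part serves as [r]. *)
Lemma rank_one_splitting_spectral (R : realType) n (A E : 'M[R[i]]_n) (theta y : R[i]) p q
    (hpq : (p + q)%N = n) (U : 'M[R[i]]_n) (d : 'rV[R[i]]_n) (x : 'cV[R[i]]_n) :
  `|theta| = 1 -> U \is unitarymx -> A = U *m diag_mx d *m U^t* ->
  E = theta *: (U *m (x *m x^t*) *m U^t*) -> x != 0 ->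
  (forall j, (d 0 j \in line y theta) = (j < p)%N) ->
  (forall j, x j 0 != 0 -> d 0 j \in line y theta) ->
  exists r D B, @rank_one_splitting R n A E theta y p q hpq U r D B.
Proof.
case: n / hpq A E U d x => A E U d x th1 UU AE EE x0 d_on x_on.
have VU := unitarymxK UU.
have xd : dsubmx x = 0.
  apply/matrixP=> i j; rewrite (ord1 j) !mxE; apply/eqP.
  by apply: contraT => /x_on; rewrite d_on /= ltnNge leq_addr.
have xE : x = col_mx (usubmx x) 0 by rewrite -xd vsubmxK.
(* For a point [z] of the line [(z - y) / theta] is real, so its real part recovers the
   coordinate. *)
pose D : 'M[R]_p := diag_mx (\row_i complex.Re ((d 0 (lshift q i) - y) / theta)).
have LE : theta *: complexmx D + y%:M = diag_mx (lsubmx d).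
  apply/matrixP=> i j; rewrite !mxE; have [->|_] := eqVneq i j.
    by rewrite !mulr1n -(line_coord th1) // d_on /=.
  by rewrite !mulr0n mulr0 addr0.
have UAU : U^t* *m A *m U = block_mx (diag_mx (lsubmx d)) 0 0 (diag_mx (rsubmx d)).
  by rewrite AE !mulmxA VU mul1mx -mulmxA VU mulmx1 -diag_mx_row hsubmxK.
have onE : perm_eq [seq diag_mx (lsubmx d) i i | i <- enum 'I_p]
    (eigenvals_on A (line y theta)).
  have : perm_eq (eigenvals A) ([seq diag_mx (lsubmx d) i i | i <- enum 'I_p] ++
                                [seq diag_mx (rsubmx d) i i | i <- enum 'I_q]).
    rewrite -(permPl (eigenvals_unitary_conj A UU)) UAU (permPl (eigenvals_block _ _)).
    by rewrite perm_cat // eigenvals_diag // diag_mx_is_diag.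
  move=> /(perm_filter (fun z => z \in line y theta)) /permPr.
  rewrite filter_cat /eigenvals_on => ->.
  rewrite (all_filterP _); last first.
    by apply/allP => _ /mapP[j _ ->]; rewrite !mxE eqxx mulr1n d_on /=.
  rewrite [X in _ ++ X](_ : _ = [::]) ?cats0 //.
  apply/eqP; rewrite -(negbK (_ == _)) -has_filter; apply/hasPn => _ /mapP[j _ ->].
  by rewrite !mxE eqxx mulr1n d_on /= -leqNgt leq_addr.
exists (usubmx x), D, (diag_mx (rsubmx d)).
rewrite /rank_one_splitting LE !castmx_id; split=> //.
- split=> //.
    by rewrite -(perm_size onE) size_map size_enum_ord.
  (* A nonzero coordinate of [x] has an index below [p], hence [p >= 1]. *)
  by have /cV0Pn[k /x_on] := x0; rewrite d_on; apply: leq_ltn_trans.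
- by split=> // j; rewrite AE; apply: col_eigenvector_spectral.
- split; rewrite ?diag_mx_is_diag //.
  by apply: contra x0 => /eqP x0; rewrite xE x0 col_mx0.
- split=> //; rewrite EE -scalemxAr -scalemxAl !mulmxA VU mul1mx -!mulmxA VU mulmx1.
  rewrite {1 2}xE tr_col_mx map_row_mx mul_col_row trmx0 map_mx0 !mulmx0 !mul0mx.
  by rewrite scale_block_mx !scaler0.
Qed.

Lemma normalmx_spectral (C : numClosedFieldType) n (A : 'M[C]_n) : A \is normalmx ->
  exists (V : 'M[C]_n) (d : 'rV[C]_n),
    V \is unitarymx /\ A = V *m diag_mx d *m V^t*.
Proof.
move=> /orthomx_spectralP AE; have PU := spectral_unitarymx A.
exists ((spectralmx A)^t*), (spectral_diag A).
by rewrite trmxC_unitary trmxCK -invmx_unitary.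
Qed.

Lemma mul_col_row_perm (R : pzSemiRingType) m n p (s : 'S_n) (A : 'M[R]_(m, n))
    (B : 'M[R]_(n, p)) :
  col_perm s A *m row_perm s B = A *m B.
Proof. by rewrite mul_col_perm -row_permM mulVg row_perm1. Qed.

Lemma spectral_col_perm (C : numClosedFieldType) n (s : 'S_n) (V : 'M[C]_n) (d : 'rV[C]_n) :
  col_perm s V *m diag_mx (col_perm s d) *m (col_perm s V)^t* = V *m diag_mx d *m V^t*.
Proof.
have -> : col_perm s V *m diag_mx (col_perm s d) = col_perm s (V *m diag_mx d).
  by apply/matrixP=> i j; rewrite !mul_mx_diag !mxE.
by rewrite tr_col_perm map_row_perm mul_col_row_perm.
Qed.

Lemma unitarymx_col_perm (C : numClosedFieldType) n (s : 'S_n) (V : 'M[C]_n) :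
  V \is unitarymx -> col_perm s V \is unitarymx.
Proof.
by move=> /unitarymxP VV; apply/unitarymxP; rewrite tr_col_perm map_row_perm mul_col_row_perm.
Qed.

Lemma normal_splitting (R : realType) n (A E : 'M[R[i]]_n) :
  A \is normalmx -> E \is normalmx -> \rank E = 1%N -> A + E \is normalmx ->
  exists (theta y : R[i]) (p q : nat) (hpq : (p + q)%N = n)
         (U : 'M[R[i]]_n) (r : 'cV[R[i]]_p) (D : 'M[R]_p) (B : 'M[R[i]]_q),
    rank_one_splitting A E theta y hpq U r D B.
Proof.
move=> /normalmx_spectral[V [d [VU AE]]] En rkE.
have [theta [u [th1 u0 ->]]] := normal_rank1P En rkE.
have [x uE] : exists x : 'cV_n, u = V *m x.
  by exists (V^t* *m u); rewrite mulmxA (unitarymxP VU) mul1mx.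
have x0 : x != 0 by apply: contra u0 => /eqP x0; rewrite uE x0 mulmx0.
have /cV0Pn[k xk] := x0.
have uuE : theta *: (u *m u^t*) = theta *: (V *m (x *m x^t*) *m V^t*).
  by rewrite uE mulmx_rank1.
rewrite AE uuE; set N := diag_mx d + theta *: (x *m x^t*).
have -> : V *m diag_mx d *m V^t* + theta *: (V *m (x *m x^t*) *m V^t*) =
    (V^t*)^t* *m N *m V^t*.
  by rewrite trmxCK mulmxDr mulmxDl -scalemxAr -scalemxAl.
rewrite normalmx_unitary_conj ?trmxC_unitary // => /normal_diag_rank1 Nd.
have thC : theta * theta^* = 1 by rewrite -normCK th1 expr1n.
(* The base point is the eigenvalue [d_k] at some index [k] of the support of [x]. From
   [theta^* (d_j - d_k) = rho] and [theta theta^* = 1] follows [d_j = d_k + rho theta]. *)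
have x_on j : x j 0 != 0 -> d 0 j \in line (d 0 k) theta.
  move=> xj; rewrite inE.
  have /complex_realP[rho rhoE] := real_conj_mul_sub (Nd _ _ xj xk); exists rho => //.
  by rewrite -rhoE mulrAC [theta^* * _]mulrC thC mul1r addrC subrK.
(* The split is by membership in the line, not by the support of [x]: [p] must count every
   eigenvalue on the line, and [r] may have zero entries. *)
have [p [q [s [hpq sP]]]] := exists_split_perm (fun j => d 0 j \in line (d 0 k) theta).
exists theta, (d 0 k), p, q, hpq, (col_perm s V).
apply: (rank_one_splitting_spectral hpq th1 (unitarymx_col_perm s VU)
  (esym (spectral_col_perm s V d)) (x := row_perm s x)).
- by congr (_ *: _); rewrite -2!mulmx_rank1 mul_col_row_perm.
- apply: contra x0 => /eqP sx0; rewrite -[x]row_perm1 -(mulVg s) row_permM sx0.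
  by rewrite raddf0.
- by move=> j; rewrite mxE sP.
- by move=> j; rewrite !mxE; apply: x_on.
Qed.

(** * Spectra of [A] and [A + E], and the characterization of normality *)

Lemma splitting_eigenvals (R : realType) n (A E : 'M[R[i]]_n) (theta y : R[i]) p q
    (hpq : (p + q)%N = n) (U : 'M[R[i]]_n) (r : 'cV[R[i]]_p) (D : 'M[R]_p) (B : 'M[R[i]]_q) :
  rank_one_splitting A E theta y hpq U r D B ->
  let Lambda : 'M[R[i]]_p := theta *: complexmx D + y%:M in
  perm_eq (eigenvals A) (eigenvals_on A (line y theta) ++ eigenvals B) /\
  perm_eq (eigenvals (A + E)) (eigenvals (Lambda + theta *: (r *m r^t*)) ++ eigenvals B).
Proof.
move=> spl Lambda; have [_ [UU _] [_ /diag_mxP[d Dd] _] onE [AE _]] := spl.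
have Lambda_diag : is_diag_mx Lambda.
  apply/is_diag_mxP => i j ij; rewrite /Lambda Dd complexmx_diag !mxE.
  by rewrite -val_eqE (negPf ij) !mulr0n mulr0 addr0.
split.
- rewrite -(permPl (eigenvals_unitary_conj A UU)) AE eigenvals_castmx.
  rewrite (permPl (eigenvals_block _ _)) perm_cat2r -(permPr onE).
  exact: eigenvals_diag.
- rewrite -(permPl (eigenvals_unitary_conj (A + E) UU)) (splittingD spl) eigenvals_castmx.
  exact: eigenvals_block.
Qed.

Theorem theorem4p7 (R : realType) (n : nat) (A E : 'M[R[i]]_n)
    (A_normal : A \is normalmx) (E_normal : E \is normalmx)
    (E_rank1 : \rank E = 1%N) :
  (A + E \is normalmx <->
   exists (theta y : R[i]) (p q : nat) (hpq : (p + q)%N = n)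
          (U : 'M[R[i]]_n) (r : 'cV[R[i]]_p) (D : 'M[R]_p) (B : 'M[R[i]]_q),
     rank_one_splitting A E theta y hpq U r D B)
  /\
  (forall (theta y : R[i]) (p q : nat) (hpq : (p + q)%N = n)
          (U : 'M[R[i]]_n) (r : 'cV[R[i]]_p) (D : 'M[R]_p) (B : 'M[R[i]]_q),
     rank_one_splitting A E theta y hpq U r D B ->
     let Lambda : 'M[R[i]]_p := theta *: complexmx D + y%:M in
     let Lambda' : 'M[R[i]]_p := Lambda + theta *: (r *m r^t*) in
     [/\ size (eigenvals B) = (n - p)%N,
         perm_eq (eigenvals A)
                 (eigenvals_on A (line y theta) ++ eigenvals B),
         perm_eq (eigenvals (A + E)) (eigenvals Lambda' ++ eigenvals B),
         Lambda' = theta *: (complexmx D + r *m r^t*) + y%:M &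
         exists s t : seq R,
           [/\ sorted_eigenvals (complexmx D) s,
               sorted_eigenvals (complexmx D + r *m r^t*) t,
               perm_eq (eigenvals_on A (line y theta))
                       [seq y + x%:C * theta | x <- s],
               perm_eq (eigenvals Lambda') [seq y + x%:C * theta | x <- t] &
               interlacing p s t]]).
Proof.
split; first split.
- exact: normal_splitting.
- by move=> [theta [y [p [q [hpq [U [r [D [B]]]]]]]]]; apply: splitting_normal.
move=> theta y p q hpq U r D B spl Lambda Lambda'.
have [eigA eigAE] := splitting_eigenvals spl.
have Lambda'E : Lambda' = theta *: (complexmx D + r *m r^t*) + y%:M.
  by rewrite /Lambda' /Lambda addrAC -scalerDr.
have [_ _ [_ Ddiag _] onE _] := spl.
split; [by rewrite size_eigenvals -hpq addKn|exact: eigA|exact: eigAE|exact: Lambda'E|].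
have [s [t [sD st onD Lt interl]]] := rank1_interlacing theta y r Ddiag.
(* By [onE] the eigenvalues of [A] on the line are the diagonal entries of [Lambda], whose real
   coordinates are listed by [s]. *)
exists s, t; rewrite Lambda'E -(permPl onE).
by split; [exact: sD|exact: st|exact: onD|exact: Lt|exact: interl].
Qed.
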